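(* Let $\mathcal{X} := (X, =_X, \neq_X, <_X)$ be an $\exists$-well-founded set, and let $A \subseteq X$. Then, constructively: (i) $\forall_{x \in X}\, \neg(x <_X x)$. (ii) If $A$ has no minimal elements, then $A$ is strongly empty. (iii) If $(x_n)_{n \in \mathbb{N}}$ is an infinite descending sequence in $X$, then $A := \{x_n \mid n \in \mathbb{N}\}$ is strongly empty.
   Context: Setting: Bishop-style constructive mathematics (intuitionistic reasoning). $\bot_{\mathbb{N}} := (0 =_{\mathbb{N}} 1)$, and $\neg P := (P \Rightarrow \bot_{\mathbb{N}})$. A set with an extensional inequality and relation is a structure $\mathcal{X} = (X, =_X, \neq_X, <_X)$, where $=_X$ is an equivalence relation (the equality of $X$); $\neq_X$ is a binary relation on $X$ such that $x =_X y \ \&\ x \neq_X y \Rightarrow \bot_{\mathbb{N}}$, $x \neq_X y \Rightarrow y \neq_X x$, and $\neq_X$ is extensional ($x =_X x'$, $y =_X y'$ and $x \neq_X y$ imply $x' \neq_X y'$); and $<_X$ is an extensional binary relation on $X$ ($x =_X x'$, $y =_X y'$ and $x <_X y$ imply $x' <_X y'$). No further property of $<_X$ is assumed. A formula $P(x)$ on $X$ is extensional if $x =_X y$ and $P(x)$ imply $P(y)$. All subsets are extensional, i.e. of the form $\{x \in X \mid P(x)\}$ with $P$ extensional; in particular $\{x_n \mid n \in \mathbb{N}\} = \{x \in X \mid \exists_{n \in \mathbb{N}}(x =_X x_n)\}$. $\mathcal{X}$ is an $\exists$-well-founded set if for all extensional formulas $Q(x), P(x)$ on $X$ with $$\forall_{x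 \in X}\Big(Q(x) \Rightarrow \big[P(x) \vee \exists_{x' \in X}(x' <_X x \ \&\ Q(x'))\big]\Big),$$ one has $\exists_{x \in X} Q(x) \Rightarrow \exists_{x \in X} P(x)$. A subset $A$ of $X$ has no minimal elements if $\forall_{x \in A}\exists_{y \in A}(y <_X x)$. $A$ is strongly empty if $A \subseteq \{x \in X \mid x \neq_X x\}$. A sequence $(x_n)_{n\in\mathbb{N}}$ in $X$ is infinite descending if $x_{n+1} <_X x_n$ for all $n$. *)

(* Defs.v *)
From Stdlib Require Import RelationClasses Morphisms.

Set Implicit Arguments.
Unset Strict Implicit.

Declare Scope bishop_scope.
Local Open Scope bishop_scope.

(* In Bishop-style mathematics falsum is the equation 0 = 1 between naturals,
   and negation is defined from it rather than from [False]. *)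
Definition bot_nat : Prop := 0 = 1.
Definition bneg (P : Prop) : Prop := P -> bot_nat.

(* [Proper (R ==> R ==> Basics.impl) S] unfolds to: x R x', y R y' and S x y
   imply S x' y'.  Nothing beyond extensionality is required of [blt]. *)
Record ordered_bset : Type := OrderedBSet {
  carrier :> Type;
  beq : carrier -> carrier -> Prop;
  bneq : carrier -> carrier -> Prop;
  blt : carrier -> carrier -> Prop;
  beq_equiv : Equivalence beq;
  bneq_beq : forall x y, beq x y /\ bneq x y -> bot_nat;
  bneq_sym : Symmetric bneq;
  bneq_ext : Proper (beq ==> beq ==> Basics.impl) bneq;
  blt_ext : Proper (beq ==> beq ==> Basics.impl) blt
}.

Arguments beq {_} _ _.
Arguments bneq {_} _ _.
Arguments blt {_} _ _.

Notation "x =b y" := (beq x y) (at level 70, no associativity) : bishop_scope.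
Notation "x <>b y" := (bneq x y) (at level 70, no associativity) : bishop_scope.
Notation "x <b y" := (blt x y) (at level 70, no associativity) : bishop_scope.

Definition extensional (X : ordered_bset) (P : X -> Prop) : Prop :=
  Proper (beq ==> Basics.impl) P.

Definition exists_well_founded (X : ordered_bset) : Prop :=
  forall Q P : X -> Prop,
    extensional Q -> extensional P ->
    (forall x : X, Q x -> P x \/ exists x' : X, x' <b x /\ Q x') ->
    (exists x : X, Q x) -> exists x : X, P x.

Record bsubset (X : ordered_bset) : Type := BSubset {
  mem :> X -> Prop;
  mem_ext : extensional mem
}.

Definition bincl (X : ordered_bset) (A B : bsubset X) : Prop :=
  forall x : X, A x -> B x.

Lemma self_apart_ext (X : ordered_bset) : extensional (fun x : X => x <>b x).
Proof. intros x y e. exact (bneq_ext e e). Qed.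

Definition self_apart (X : ordered_bset) : bsubset X :=
  BSubset (@self_apart_ext X).

Lemma seq_range_ext (X : ordered_bset) (u : nat -> X) :
  extensional (fun x : X => exists n, x =b u n).
Proof.
  intros x y e [n h]; exists n.
  destruct (beq_equiv X) as [_ sym trans].
  exact (trans y x (u n) (sym x y e) h).
Qed.

Definition seq_range (X : ordered_bset) (u : nat -> X) : bsubset X :=
  BSubset (@seq_range_ext X u).

Definition no_minimal_elements (X : ordered_bset) (A : bsubset X) : Prop :=
  forall x : X, A x -> exists y : X, A y /\ y <b x.

Definition strongly_empty (X : ordered_bset) (A : bsubset X) : Prop :=
  bincl A (self_apart X).

Definition infinite_descending (X : ordered_bset) (u : nat -> X) : Prop :=
  forall n : nat, u (S n) <b u n.

(* Main.v *)
Require Import Defs.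

(** Well-foundedness in the existential form turns an inhabited set without
    minimal elements into a proof of any proposition [R] whatsoever: take [Q] to
    be membership in the set and [P] to be the constant formula [R]; the
    progress hypothesis always holds through its second disjunct, so
    well-foundedness returns a point at which [R] holds
    ([no_minimal_elements_explosion]).  The three claims are the instances of
    this principle given by suitable [R].  For strong emptiness of a set, [R] is
    the inequality of the given member with itself.  The range of a descending
    sequence has no minimal elements ([descending_range_no_minimal_elements]),
    which reduces the claim on sequences to the one on subsets; and [x <b x]
    says exactly that the constant sequence [x] is descending, so irreflexivity
    is explosion for its range, with [R] the falsum [bot_nat].  Since [R] is
    arbitrary, no appeal to ex falso is made. *)

Local Open Scope bishop_scope.

(** Instantiating [P] with a constant formula makes its extensionality trivial
    and lets the witness supplied by well-foundedness be forgotten. *)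
Lemma no_minimal_elements_explosion (X : ordered_bset)
    (hX : exists_well_founded X) (A : bsubset X) (R : Prop) :
  no_minimal_elements A -> (exists x : X, A x) -> R.
Proof.
  intros hA inhA.
  destruct (hX A (fun _ => R)) as [_ r].
  - exact (@mem_ext X A).
  - intros x y _ r; exact r.
  - intros x Ax; right.
    destruct (hA x Ax) as [y [Ay yx]].
    exists y; split; assumption.
  - exact inhA.
  - exact r.
Qed.

Lemma seq_range_term (X : ordered_bset) (u : nat -> X) (n : nat) :
  seq_range u (u n).
Proof. exists n; destruct (beq_equiv X) as [refl _ _]; exact (refl (u n)). Qed.

(** A member of the range is only equal, in the sense of [beq], to some term
    [u n]; extensionality of the relation carries [u (S n) <b u n] over to it. *)
Lemma descending_range_no_minimal_elements (X : ordered_bset) (u : nat -> X) :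
  infinite_descending u -> no_minimal_elements (seq_range u).
Proof.
  intros hu x [n e].
  exists (u (S n)); split.
  - apply seq_range_term.
  - destruct (beq_equiv X) as [refl sym _].
    exact (blt_ext (refl (u (S n))) (sym _ _ e) (hu n)).
Qed.

Theorem proposition6p3 (X : ordered_bset) (hX : exists_well_founded X)
    (A : bsubset X) :
  (forall x : X, bneg (x <b x)) /\
  (no_minimal_elements A -> strongly_empty A) /\
  (forall u : nat -> X, infinite_descending u -> strongly_empty (seq_range u)).
Proof.
  assert (empty : forall B : bsubset X,
             no_minimal_elements B -> strongly_empty B).
  { intros B hB x Bx.
    exact (no_minimal_elements_explosion X hX B (x <>b x) hB
             (ex_intro _ x Bx)). }
  split; [| split].
  - intros x xx.
    apply (no_minimal_elements_explosion X hX (seq_range (fun _ => x))).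
    + apply descending_range_no_minimal_elements; intros _; exact xx.
    + exists x; exact (seq_range_term X (fun _ => x) 0).
  - apply empty.
  - intros u hu; apply empty, descending_range_no_minimal_elements, hu.
Qed.
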